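(* Consider the two-agent, single-item environment with i.i.d. values. Let $\mathcal F$ be any scale-closed family of distributions on $[0,\infty)$ with finite first moment, and let allocation and payment rules be Borel measurable. Suppose that for some constant $\rho\ge 0$ a feasible, dominant strategy incentive compatible (DSIC), and ex-post individually rational (IR) mechanism $M$ satisfies $$M(F)\ \ge\ \rho\,\mathrm{OPT}(F)\qquad\text{for every }F\in\mathcal F .$$ Then there exists a feasible, DSIC, ex-post IR, and scale-invariant mechanism $\widehat M$ satisfying the same inequalities, i.e. $\widehat M(F)\ge\rho\,\mathrm{OPT}(F)$ for every $F\in\mathcal F$ (thus $\widehat M$ has a worst-case approximation ratio over $\mathcal F$ no worse than that of $M$). If $M$ is highest-value-only, then $\widehat M$ can also be chosen highest-value-only.
   Context: A single item is sold to two agents with values $v=(v_1,v_2)\in[0,\infty)^2$ drawn i.i.d. from a distribution $F$. A mechanism $M=(x,p)$ consists of Borel measurable maps from value profiles to allocation probabilities $x_i(v)\in[0,1]$ and payments $p_i(v)\in\mathbb R$, $i=1,2$. Write $v_{-i}$ for the other agent's value. The mechanism is: - feasible if $x_1(v)+x_2(v)\le 1$ for all $v$; - DSIC if $v_i x_i(v)-p_i(v)\ge v_i x_i(z,v_{-i})-p_i(z,v_{-i})$ for all $v,i,z$; - ex-post IR if $v_i x_i(v)-p_i(v)\ge 0$ for all $v,i$; - highest-value-only if for every profile $v$ and $i\ne j$, $v_i<v_j$ implies $x_i(v)=0$; - scale invariant if $x_i(a v)=x_i(v)$ for every agent $i$, every profile $v$ and every constant $a>0$. The expected revenue is $M(F)=\mathbf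 E_{v\sim F\times F}[p_1(v)+p_2(v)]$. The optimal revenue is $\mathrm{OPT}(F)=\sup_M M(F)$, the supremum over all feasible, DSIC, ex-post IR mechanisms. The worst-case approximation ratio of $M$ over $\mathcal F$ is $\sup_{F\in\mathcal F}\mathrm{OPT}(F)/M(F)$. A family $\mathcal F$ of distributions is scale closed if for every $F\in\mathcal F$ and every $s>0$, the law of $sV$ with $V\sim F$ also belongs to $\mathcal F$. *)

(* Defs.v *)
From HB Require Import structures.
From mathcomp Require Import all_boot all_order all_algebra.
From mathcomp Require Import all_classical all_reals all_analysis.
Import Order.TTheory GRing.Theory Num.Theory.
Import numFieldNormedType.Exports.

Set Implicit Arguments.
Unset Strict Implicit.
Unset Printing Implicit Defensive.

Local Open Scope classical_set_scope.
Local Open Scope ring_scope.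

(* The two agents are the booleans: [false] is agent 1,
   [true] is agent 2, and [~~ i] is the opponent of [i]. *)

Section Mechanisms.
Variable R : realType.

Definition profile := (R * R)%type.

Definition value (v : profile) (i : bool) : R := if i then v.2 else v.1.

(* [deviate v i z] is the profile (z, v_{-i}) *)
Definition deviate (v : profile) (i : bool) (z : R) : profile :=
  if i then (v.1, z) else (z, v.2).

Definition scale (a : R) (v : profile) : profile := (a * v.1, a * v.2).

Definition profiles : set profile := [set v | 0 <= v.1 /\ 0 <= v.2].

(* Rules are total functions on R^2, but only their restriction to [profiles]
   is constrained, and only that restriction is used below. *)
Record mechanism := Mechanism {
  alloc : bool -> profile -> R;
  pay : bool -> profile -> R;
  measurable_alloc : forall i, measurable_fun profiles (alloc i);
  measurable_pay : forall i, measurable_fun profiles (pay i);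
  alloc_prob : forall i v, profiles v -> 0 <= alloc i v <= 1 }.

Definition feasible (M : mechanism) : Prop :=
  forall v, profiles v -> alloc M false v + alloc M true v <= 1.

Definition dsic (M : mechanism) : Prop :=
  forall v i z, profiles v -> 0 <= z ->
    value v i * alloc M i (deviate v i z) - pay M i (deviate v i z)
      <= value v i * alloc M i v - pay M i v.

Definition ex_post_ir (M : mechanism) : Prop :=
  forall v i, profiles v -> 0 <= value v i * alloc M i v - pay M i v.

Definition highest_value_only (M : mechanism) : Prop :=
  forall v i, profiles v -> value v i < value v (~~ i) -> alloc M i v = 0.

Definition scale_invariant (M : mechanism) : Prop :=
  forall i v a, profiles v -> 0 < a -> alloc M i (scale a v) = alloc M i v.

(* Under ex-post IR and a finite first moment the positive part of the
   integrand is integrable, so this is the expectation, possibly -oo. *)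
Definition revenue (M : mechanism) (F : probability R R) : \bar R :=
  (\int[F \x F]_(v in profiles) (pay M false v + pay M true v)%:E)%E.

Definition opt (F : probability R R) : \bar R :=
  ereal_sup [set revenue M F | M in
    [set M | [/\ feasible M, dsic M & ex_post_ir M]]].

(* The library's conventions x / 0 = x * +oo and 0 * +oo = 0 make a summand
   with zero revenue count as +oo if opt F > 0 and as 0 if opt F = 0.
   The ratio is meaningful only when revenues over Fam are nonnegative. *)
Definition approx_ratio (M : mechanism) (Fam : set (probability R R)) :
    \bar R :=
  ereal_sup [set (opt F / revenue M F)%E | F in Fam].

Definition nonneg_finite_mean (F : probability R R) : Prop :=
  F `[0, +oo[%classic = 1%E /\ F.-integrable setT EFin.

(* The law of s V belongs to the family up to agreement on Borel sets: a
   probability here also carries irrelevant values on non-measurable sets. *)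
Definition scale_closed (Fam : set (probability R R)) : Prop :=
  forall F (s : R), Fam F -> 0 < s ->
    exists2 G, Fam G & forall A : set R, measurable A ->
      G A = pushforward F (fun x : R => s * x) A.

End Mechanisms.

(* Main.v *)
(** Average the allocation rule of [M] logarithmically over the rescalings
    [v |-> e^t v], [0 <= t <= n], and charge the canonical payments
    [v_i x_i(v) - \int_0^{v_i} x_i(z, v_{-i}) dz], the largest ones compatible
    with DSIC and ex-post IR.  Revenue under [F] of the rule rescaled by [a] is
    [1/a] times revenue under the law of [a V], while [OPT] is homogeneous, so
    every average inherits each guarantee that [M] has along the orbit of [F].
    The averages are asymptotically scale invariant, hence determined in the
    limit by monotone functions of one variable: one per agent, as a function of
    [v_i / v_{-i}], together with the constant values on the axes.  Helly
    selection then gives a subsequence converging at every profile; this makes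
    the limit measurable and lets revenue pass to it by dominated
    convergence. *)

Require Import Defs.
From HB Require Import structures.
From mathcomp Require Import all_boot all_order all_algebra.
From mathcomp Require Import all_classical all_reals all_analysis.
From mathcomp Require Import measurable_realfun ring lra.
Import Order.TTheory GRing.Theory Num.Theory.
Import numFieldNormedType.Exports.
Local Open Scope classical_set_scope.
Local Open Scope ring_scope.

(** * Integrals over intervals *)

Section Interval_integrals.
Context {R : realType}.
Local Notation mu := (@lebesgue_measure R).

Let affine (a b : R) : measurableTypeR R -> measurableTypeR R :=
  fun x => (a * x + b)%R.

Let measurable_affine (a b : R) : measurable_fun setT (affine a b).
Proof. by apply: measurable_funD => //; exact: measurable_funM. Qed.

(** Lebesgue measure is determined by its values on half-open intervals, and there the pushforward
    multiplied by [a] has the right length. *)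
Lemma lebesgue_measure_affine (a b : R) (A : set R) : 0 < a -> measurable A ->
  (a%:E * pushforward mu (affine a b) A = mu A)%E.
Proof.
move=> a0 mA.
pose phi : {mfun measurableTypeR R >-> measurableTypeR R} :=
  HB.pack (affine a b)
    (isMeasurableFun.Build _ _ _ _ _ (measurable_affine a b)).
have a0' : 0 <= a by exact: ltW.
apply/esym.
apply: (@lebesgue_measure_unique _ (mscale (NngNum a0') (pushforward mu phi)))
  => //.
move=> _ [[c d]] _ <-.
rewrite /= /mscale /= /pushforward.
have -> : (phi @^-1` `]c, d]%classic) = `](c - b) / a, (d - b) / a]%classic.
  apply/seteqP; split => x /=; rewrite !in_itv/= ltr_pdivrMr// ler_pdivlMr//;
  rewrite /affine ltrBlDr lerBrDr mulrC //.
rewrite !lebesgue_measure_itv/= !lte_fin ltr_pM2r ?invr_gt0//.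
rewrite ltrBlDr subrK; case: ifP => // cd; last by rewrite mule0.
rewrite -EFinD -EFinM; congr EFin.
by field; rewrite gt_eqF.
Qed.

Lemma ge0_integral_affine (a b c d : R) (f : R -> \bar R) : 0 < a ->
  measurable_fun [set: R] f -> (forall x, 0 <= f x)%E ->
  (\int[mu]_(x in `[(a * c + b)%R, (a * d + b)%R]) f x =
   a%:E * \int[mu]_(x in `[c, d]) f (a * x + b)%R)%E.
Proof.
move=> a0 mf f0.
pose phi : {mfun measurableTypeR R >-> measurableTypeR R} :=
  HB.pack (affine a b)
    (isMeasurableFun.Build _ _ _ _ _ (measurable_affine a b)).
have -> : (\int[mu]_(x in `[c, d]) f (a * x + b)%R =
  \int[pushforward mu (affine a b)]_(x in
    `[(a * c + b)%R, (a * d + b)%R]) f x)%E.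
  rewrite ge0_integral_pushforward//=; last exact: measurable_funS mf.
  apply: congr2 => //; apply/seteqP; split => x /=;
    by rewrite /affine !in_itv/= !lerD2r !ler_pM2l.
have a0' : 0 <= a by exact: ltW.
rewrite -(@ge0_integral_mscale _ _ _ (pushforward mu phi) _ _ (NngNum a0'))//.
  by apply: eq_measure_integral => A mA _; apply/esym;
    exact: lebesgue_measure_affine.
exact: measurable_funS mf.
Qed.

Definition unit_valued (f : R -> R) :=
  measurable_fun setT f /\ forall x, 0 <= f x <= 1.

Lemma itv_measure_fin (a b : R) : (mu (`[a, b]%classic : set R) < +oo)%E.
Proof.
by rewrite lebesgue_measure_itv; case: ifP => _; rewrite ?ltry// -EFinB ltry.
Qed.

Lemma itv_measure (a b : R) : a <= b ->
  mu (`[a, b]%classic : set R) = (b - a)%:E.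
Proof.
rewrite lebesgue_measure_itv/= lte_fin le_eqVlt => /predU1P[->|->]//.
by rewrite ltxx subrr.
Qed.

Lemma integrable_itv (f : R -> R) a b : unit_valued f ->
  mu.-integrable `[a, b] (EFin \o f).
Proof.
move=> [mf f01]; apply: measurable_bounded_integrable => //.
- exact: itv_measure_fin.
- exact: measurable_funS mf.
- exists 1; split; first by [].
  move=> x /ltW x1 y _ /=; apply: le_trans x1; have := f01 y.
  by case/andP => f0 f1; rewrite ger0_norm.
Qed.

Lemma itv_integral_bounds (f : R -> R) a b : unit_valued f -> a <= b ->
  0 <= \int[mu]_(x in `[a, b]) f x <= b - a.
Proof.
move=> uf ab; have [mf f01] := uf.
rewrite Rintegral_ge0/=; last by move=> x _; have /andP[] := f01 x.
have <- : \int[mu]_(x in `[a, b]) (cst 1 x) = b - a.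
  by rewrite Rintegral_cst// mul1r [X in fine X]itv_measure.
apply: le_Rintegral => //; first exact: integrable_itv.
  by apply: integrable_itv; split => // x; rewrite ler01 lexx.
by move=> x _; have /andP[] := f01 x.
Qed.

Lemma itv_integral_split (f : R -> R) a b c :
  unit_valued f -> a <= b -> b <= c ->
  \int[mu]_(x in `[a, c]) f x =
  \int[mu]_(x in `[a, b]) f x + \int[mu]_(x in `[b, c]) f x.
Proof.
move=> uf ab bc.
rewrite -(Rintegral_itv_obnd_cbnd (b := BRight c) (r := b)); last first.
  apply: integrableS (integrable_itv _ b c uf) => //.
  by apply: subset_itvr; rewrite bnd_simp.
rewrite -(@Rintegral_itvB _ _ (BLeft a) (BRight c) b)//;
  first by rewrite addrC subrK.
exact: integrable_itv.
Qed.

Lemma unit_valued_affine (f : R -> R) (a b : R) : unit_valued f ->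
  unit_valued (fun x => f (a * x + b)).
Proof.
move=> [mf f01]; split => //.
apply: measurableT_comp => //; exact: measurable_affine.
Qed.

Lemma itv_integral_affine (f : R -> R) a b c d : unit_valued f -> 0 < a ->
  \int[mu]_(x in `[a * c + b, a * d + b]) f x =
  a * \int[mu]_(x in `[c, d]) f (a * x + b).
Proof.
move=> uf a0; have [mf f01] := uf.
rewrite /Rintegral ge0_integral_affine//.
- rewrite fineM//; apply: integrable_fin_num => //.
  exact/integrable_itv/unit_valued_affine.
- exact/measurable_EFinP.
- by move=> x; rewrite lee_fin; case/andP : (f01 x).
Qed.

(** After multiplication by [n] the two integrals run over [[b, n + b]] and [[0, n]]. For [b >= 0]
    they differ by the integrals over the end pieces [[0, b]] and [[n, n + b]], each between [0] and
    [b]. This is the source of asymptotic scale invariance. *)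
Lemma average_shift (f : R -> R) (n b : R) : unit_valued f -> 0 < n ->
  `|\int[mu]_(u in `[0, 1]) f (n * u + b) - \int[mu]_(u in `[0, 1]) f (n * u)|
    <= `|b| / n.
Proof.
move=> + n0; wlog b0 : f b / 0 <= b.
  (* For [b < 0], the function shifted by [b], taken with the shift [- b], yields the same two
     integrals in the opposite order. *)
  move=> H uf; have [|b0] := leP 0 b; first by move=> b0; exact: H.
  have := H (fun x => f (1 * x + b)) (- b).
  rewrite oppr_ge0 (ltW b0) normrN distrC => /(_ erefl (unit_valued_affine _ _
    _ uf)).
  under eq_Rintegral do rewrite mul1r.
  by under [X in `|_ - X|]eq_Rintegral do rewrite mul1r addrNK.
move=> uf; rewrite (ger0_norm b0) ler_pdivlMr// -[X in _ * X](gtr0_norm n0)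
  -normrM.
rewrite mulrC mulrBr -itv_integral_affine//.
have -> : \int[mu]_(u in `[0, 1]) f (n * u) =
    \int[mu]_(u in `[0, 1]) f (n * u + 0).
  by under [RHS]eq_Rintegral do rewrite addr0.
rewrite -itv_integral_affine// mulr0 mulr1 !add0r addr0.
have h1 := @itv_integral_split f 0 b (n + b) uf b0.
have h2 := @itv_integral_split f 0 n (n + b) uf (ltW n0).
have h3 := itv_integral_bounds _ _ _ uf b0.
have : n <= n + b by rewrite lerDl.
move=> nnb; have h4 := itv_integral_bounds _ _ _ uf nnb.
have bnb : b <= n + b by rewrite lerDr ltW.
move: h3 h4; rewrite subr0 addrAC subrr add0r ler_norml => /andP[h3 h5]
  /andP[h4 h6].
have := h1 bnb; rewrite h2// => h7.
apply/andP; split; lra.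
Qed.

End Interval_integrals.

(** * Envelope of a monotone allocation *)

Section Envelope.
Context {R : realType}.
Local Notation mu := (@lebesgue_measure R).

Definition nonneg_monotone (f : R -> R) :=
  forall x y, 0 <= x -> x <= y -> f x <= f y.

Lemma monotone_itv_integral (f : R -> R) a b :
  unit_valued f -> nonneg_monotone f ->
  0 <= a -> a <= b ->
  (b - a) * f a <= \int[mu]_(x in `[a, b]) f x <= (b - a) * f b.
Proof.
move=> uf mf a0 ab.
have cstE c : 0 <= c <= 1 -> \int[mu]_(x in `[a, b]) (cst c x) = (b - a) * c /\
    mu.-integrable `[a, b] (EFin \o cst c).
  move=> c01; split; last by apply: integrable_itv; split.
  by rewrite Rintegral_cst// mulrC [X in fine X]itv_measure.
have [Ea ia] := cstE _ (uf.2 a); have [Eb ib] := cstE _ (uf.2 b).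
apply/andP; split; [rewrite -Ea|rewrite -Eb]; apply: le_Rintegral => //;
  try exact: integrable_itv; move=> x /=; rewrite in_itv/= => /andP[ax xb].
- exact: mf.
- by apply: mf => //; exact: le_trans ax.
Qed.

(* [\int_0^v f], written over the unit interval so that rescaling the values
   only rescales the prefactor. *)
Definition utility (f : R -> R) v := v * \int[mu]_(s in `[0, 1]) f (v * s).

Lemma utilityE (f : R -> R) v : unit_valued f -> 0 <= v ->
  utility f v = \int[mu]_(x in `[0, v]) f x.
Proof.
move=> uf; rewrite le_eqVlt => /predU1P[<-|v0].
  by rewrite /utility mul0r set_itv1 Rintegral_set1.
have := itv_integral_affine _ v 0 0 1 uf v0.
rewrite mulr0 mulr1 !addr0 => ->.
by under eq_Rintegral do rewrite addr0.
Qed.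

(** Between [z] and [v] a monotone [f] stays on one side of [f z], so [f z] is a subgradient of the
    convex function [utility f] at [z]. This inequality is exactly DSIC for the canonical
    payments. *)
Lemma utility_subgradient (f : R -> R) z v :
  unit_valued f -> nonneg_monotone f ->
  0 <= z -> 0 <= v -> utility f z + (v - z) * f z <= utility f v.
Proof.
move=> uf mf z0 v0; rewrite !utilityE//; have [zv|/ltW vz] := leP z v.
  rewrite (itv_integral_split _ 0 z v)// lerD2l.
  by have /andP[] := monotone_itv_integral _ _ _ uf mf z0 zv.
rewrite (itv_integral_split _ 0 v z)// -addrA gerDl.
have /andP[_] := monotone_itv_integral _ _ _ uf mf v0 vz.
lra.
Qed.

(** An envelope inequality that avoids differentiating [u]: the subgradient inequalities are summed
    over a uniform grid and compared with Riemann sums of [f]. *)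
Lemma utility_le_subgradient (f u : R -> R) v :
  unit_valued f -> nonneg_monotone f ->
  (forall z z', 0 <= z -> 0 <= z' -> u z + (z' - z) * f z <= u z') ->
  0 <= u 0 -> 0 <= v -> utility f v <= u v.
Proof.
move=> uf mf fu u0 v0; rewrite utilityE//.
suff H n : \int[mu]_(x in `[0, v]) f x <= u v + v / n.+1%:R.
  apply/ler_addgt0Pr => e e0.
  have nP := archi_boundP (divr_ge0 v0 (ltW e0)); set n := Num.bound _ in nP.
  apply: le_trans (H n) _; rewrite lerD2l ler_pdivrMr ?ltr0n//.
  rewrite mulrC -ler_pdivrMr//; apply: le_trans (ltW nP) _.
  by rewrite ler_nat.
(* On the grid of mesh [d], the lower Riemann sum of [f] is at most
   [u v - u 0], and the upper one exceeds it by [d * (f v - f 0)]. *)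
set d := v / n.+1%:R.
have d0 : 0 <= d by rewrite divr_ge0.
have step k : \int[mu]_(x in `[0, k%:R * d]) f x <=
    u (k%:R * d) + d * (f (k%:R * d) - f 0).
  elim: k => [|k IH]; first by rewrite mul0r set_itv1 Rintegral_set1 subrr
    mulr0 addr0.
  have kd : 0 <= k%:R * d by rewrite mulr_ge0.
  have kd' : k%:R * d <= k.+1%:R * d by rewrite ler_wpM2r// ler_nat.
  have dE : k.+1%:R * d = k%:R * d + d by rewrite -natr1 mulrDl mul1r.
  rewrite (itv_integral_split _ 0 (k%:R * d))//.
  (* On each cell the integral is bounded through the right endpoint and the increment of [u]
     through the left one; the discrepancy [d * (f right - f left)] telescopes. *)
  have /andP[_] := monotone_itv_integral _ _ _ uf mf kd kd'.
  have := fu _ _ kd (le_trans kd kd').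
  move: IH; rewrite dE addrAC subrr add0r.
  set A := \int[mu]_(x in `[0, _]) f x; set B := \int[mu]_(x in `[_, _]) f x.
  nra.
have := step n.+1; rewrite (_ : n.+1%:R * d = v); last first.
  by rewrite /d mulrC divfK// pnatr_eq0.
move/le_trans; apply; rewrite lerD2l ler_piMr//.
have := uf.2 v; have := uf.2 0; lra.
Qed.

End Envelope.

(** * Tonelli and measurability of parametric integrals on subdomains *)

Section Fubini.
Context {d1 d2} {T1 : measurableType d1} {T2 : measurableType d2}
  {R : realType}.
Variables (m1 : {sigma_finite_measure set T1 -> \bar R})
  (m2 : {sigma_finite_measure set T2 -> \bar R}).

(** Extension by zero off the rectangle reduces this to Tonelli on the whole product. Nonnegativity
    is asked on the rectangle only, because canonical payments are known to be nonnegative only on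
    [profiles]. *)
Lemma tonelli_in (D1 : set T1) (D2 : set T2) (f : T1 -> T2 -> \bar R) :
  measurable D1 -> measurable D2 ->
  measurable_fun setT (fun z : T1 * T2 => f z.1 z.2) ->
  (forall x y, D1 x -> D2 y -> 0 <= f x y)%E ->
  (\int[m1]_(x in D1) \int[m2]_(y in D2) f x y =
   \int[m2]_(y in D2) \int[m1]_(x in D1) f x y)%E.
Proof.
move=> mD1 mD2 mf f0.
pose g := (fun z : T1 * T2 => f z.1 z.2) \_ (D1 `*` D2).
have mg : measurable_fun setT g.
  by apply/(measurable_restrictT _ (measurableX mD1 mD2));
    exact: measurable_funS mf.
have g0 z : (0 <= g z)%E.
  by rewrite /g patchE; case: ifPn => // /set_mem[]; exact: f0.
rewrite integral_mkcond [RHS]integral_mkcond.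
transitivity (\int[m1]_x \int[m2]_y g (x, y))%E; last first.
  rewrite (fubini_tonelli g)//.
  apply: eq_integral => y _; rewrite [RHS]patchE; case: ifPn => yD.
    rewrite [RHS]integral_mkcond; apply: eq_integral => x _.
    by rewrite /g !patchE in_setX yD andbT.
  by apply: integral0_eq => x _; rewrite /g patchE in_setX (negbTE yD) andbF.
apply: eq_integral => x _; rewrite [LHS]patchE; case: ifPn => xD.
  rewrite [LHS]integral_mkcond; apply: eq_integral => y _.
  by rewrite /g !patchE in_setX xD.
by apply/esym/integral0_eq => y _; rewrite /g patchE in_setX (negbTE xD).
Qed.

Lemma measurable_integral_param (D2 : set T2) (f : T1 -> T2 -> \bar R) :
  measurable D2 -> measurable_fun setT (fun z : T1 * T2 => f z.1 z.2) ->
  (forall x y, D2 y -> 0 <= f x y)%E ->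
  measurable_fun setT (fun x => \int[m2]_(y in D2) f x y)%E.
Proof.
move=> mD2 mf f0.
pose g := (fun z : T1 * T2 => f z.1 z.2) \_ (setT `*` D2).
have mg : measurable_fun setT g.
  apply/(measurable_restrictT _ (measurableX measurableT mD2)).
  exact: measurable_funTS.
have g0 z : (0 <= g z)%E.
  by rewrite /g patchE; case: ifPn => // /set_mem[_]; exact: f0.
apply: eq_measurable_fun (measurable_fun_fubini_tonelli_F (m2 := m2) g mg g0).
move=> x _; rewrite /fubini_F [RHS]integral_mkcond; apply: eq_integral => y _.
by rewrite /g !patchE in_setX in_setT.
Qed.

Lemma measurable_Rintegral_param (D2 : set T2) (f : T1 -> T2 -> R) :
  measurable D2 -> measurable_fun setT (fun z : T1 * T2 => f z.1 z.2) ->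
  (forall x y, 0 <= f x y) ->
  measurable_fun setT (fun x => \int[m2]_(y in D2) f x y).
Proof.
move=> mD2 mf f0; apply: measurableT_comp => //.
apply: (measurable_integral_param D2 (fun x y => (f x y)%:E)) => //.
- exact/measurable_EFinP.
- by move=> x y _; rewrite lee_fin.
Qed.

End Fubini.

(** * Algebra and measurability of deviations and rescalings of profiles *)

Section Deviations.
Context {R : realType}.
Implicit Types (v : profile R) (i : bool).

Lemma value_deviate v i z : value (deviate v i z) i = z.
Proof. by case: i. Qed.

Lemma deviate_value v i : deviate v i (value v i) = v.
Proof. by case: v => a b; case: i. Qed.

Lemma deviate_deviate v i z w : deviate (deviate v i z) i w = deviate v i w.
Proof. by case: i. Qed.

Lemma profiles_deviate v i z : profiles v -> 0 <= z -> profiles (deviate v i z).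
Proof. by move=> [? ?] ?; case: i; split. Qed.

Lemma profiles_value v i : profiles v -> 0 <= value v i.
Proof. by move=> [? ?]; case: i. Qed.

Lemma scale_deviate a v i z :
  scale a (deviate v i z) = deviate (scale a v) i (a * z).
Proof. by case: i. Qed.

Lemma value_scale a v i : value (scale a v) i = a * value v i.
Proof. by case: i. Qed.

Lemma ray_unit v i :
  deviate (scale (value v (~~ i)) (1, 1)) i (value v i) = v.
Proof. by case: v => a b; case: i; rewrite /scale/= !mulr1. Qed.

Lemma ray_axis a v i : value v (~~ i) = 0 ->
  deviate (scale a (0, 0)) i (value v i) = v.
Proof. by case: v => b c; case: i => /= ->; rewrite /scale/= !mulr0. Qed.

Lemma scale_origin a v i : value v i = 0 -> value v (~~ i) = 0 -> scale a v = v.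
Proof. by case: v => b c; case: i => /= -> ->; rewrite /scale/= !mulr0. Qed.

Lemma scale_scale a b v : scale a (scale b v) = scale (a * b) v.
Proof. by rewrite /scale/= !mulrA. Qed.

Lemma profiles_scale a v : 0 < a -> profiles (scale a v) <-> profiles v.
Proof. by move=> a0; rewrite /profiles/= !pmulr_rge0. Qed.

Lemma measurable_profiles : measurable (@profiles R).
Proof.
rewrite (_ : @profiles R = `[0, +oo[%classic `*` `[0, +oo[%classic).
  exact: measurableX.
by apply/seteqP; split => -[x y] /=; rewrite !in_itv/= !andbT.
Qed.

Lemma measurable_value i : measurable_fun setT (fun v => value v i).
Proof. by case: i => /=; [exact: measurable_snd|exact: measurable_fst]. Qed.

Lemma measurable_deviate {d} {T : measurableType d} (f : T -> profile R)
    (g : T -> R) i : measurable_fun setT f -> measurable_fun setT g ->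
  measurable_fun setT (fun t => deviate (f t) i (g t)).
Proof.
move=> mf mg.
have m1 : measurable_fun setT (fun t => (f t).1).
  by apply: measurableT_comp mf; exact: measurable_fst.
have m2 : measurable_fun setT (fun t => (f t).2).
  by apply: measurableT_comp mf; exact: measurable_snd.
by case: i; exact: measurable_fun_pair.
Qed.

Lemma measurable_scale {d} {T : measurableType d} (f : T -> profile R)
    (g : T -> R) : measurable_fun setT f -> measurable_fun setT g ->
  measurable_fun setT (fun t => scale (g t) (f t)).
Proof.
move=> mf mg.
have m1 : measurable_fun setT (fun t => (f t).1).
  by apply: measurableT_comp mf; exact: measurable_fst.
have m2 : measurable_fun setT (fun t => (f t).2).
  by apply: measurableT_comp mf; exact: measurable_snd.
by apply: measurable_fun_pair; exact: measurable_funM.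
Qed.

End Deviations.

(** * Canonical mechanism of a monotone allocation rule *)

Section Canonical_mechanism.
Context {R : realType}.
Local Notation mu := (@lebesgue_measure R).
Implicit Types (v : profile R) (i : bool) (x : bool -> profile R -> R).

(** Measurability and the bounds hold on the whole plane, so that sections are [unit_valued] on the
    whole line and integrals need no domain conditions; monotonicity is asked from [profiles]
    only. *)
Record monotone_rule x : Prop := MonotoneRule {
  rule_measurable : forall i, measurable_fun setT (x i);
  rule_unit : forall i v, 0 <= x i v <= 1;
  rule_monotone : forall i v z, profiles v -> value v i <= z ->
    x i v <= x i (deviate v i z) }.

Definition canonical_pay x i v : R :=
  value v i * x i v - utility (fun z => x i (deviate v i z)) (value v i).

Lemma section_unit x i v : monotone_rule x ->
  unit_valued (fun z => x i (deviate v i z)).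
Proof.
move=> [mx ux _]; split => //.
by apply: measurableT_comp => //; exact: measurable_deviate.
Qed.

Lemma section_monotone x i v : monotone_rule x -> profiles v ->
  nonneg_monotone (fun z => x i (deviate v i z)).
Proof.
move=> rx pv z w z0 zw; rewrite -(deviate_deviate v i z w).
apply: rule_monotone => //; first exact: profiles_deviate.
by rewrite value_deviate.
Qed.

(** Since [utility] integrates over the fixed interval [[0, 1]], it is a parametric integral whose
    domain does not depend on the profile. *)
Lemma measurable_canonical_pay x i : monotone_rule x ->
  measurable_fun setT (canonical_pay x i).
Proof.
move=> [mx ux _]; have mvi := @measurable_value R i.
apply: measurable_funB; first exact: measurable_funM.
apply: measurable_funM => //.
apply: (measurable_Rintegral_param mu _
  (fun v s => x i (deviate v i (value v i * s)))) => //=.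
- apply: measurableT_comp => //; apply: measurable_deviate.
    exact: measurable_fst.
  apply: measurable_funM; last exact: measurable_snd.
  by apply: measurableT_comp mvi _; exact: measurable_fst.
- by move=> v s; have /andP[] := ux i (deviate v i (value v i * s)).
Qed.

(** The subgradient inequality from [value v i] to [0] gives the lower bound; the one from [0] to
    [value v i] makes the utility nonnegative, hence the upper bound. The latter is what dominates
    payments in the limit arguments. *)
Lemma canonical_pay_bounds x i v : monotone_rule x -> profiles v ->
  0 <= canonical_pay x i v <= value v i.
Proof.
move=> rx pv; have v0 := profiles_value v i pv.
have ux := section_unit x i v rx; have mx := section_monotone x i v rx pv.
have h1 := utility_subgradient _ _ 0 ux mx v0 (lexx 0).
have h2 := utility_subgradient _ 0 _ ux mx (lexx 0) v0.
have U0 : utility (fun z => x i (deviate v i z)) 0 = 0 by rewrite /utility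
  mul0r.
move: h1 h2; rewrite /canonical_pay U0 deviate_value.
set U := utility _ _.
have /andP[h1 h2] := rule_unit _ rx i v.
have /andP[h3 h4] := rule_unit _ rx i (deviate v i 0).
move=> h5 h6; have : 0 <= value v i * x i (deviate v i 0) by exact: mulr_ge0.
have : value v i * x i v <= value v i by rewrite ler_piMr.
by move=> h7 h8; apply/andP; split; lra.
Qed.

Definition canonical_mechanism x (rx : monotone_rule x) : mechanism R :=
  Mechanism (fun i => measurable_funTS (rule_measurable _ rx i))
    (fun i => measurable_funTS (measurable_canonical_pay x i rx))
    (fun i v _ => rule_unit _ rx i v).

Lemma canonical_dsic x (rx : monotone_rule x) : dsic (canonical_mechanism x rx).
Proof.
move=> v i z pv z0 /=; rewrite /canonical_pay value_deviate.
under [X in utility X _]eq_fun do rewrite deviate_deviate.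
have := utility_subgradient _ _ _ (section_unit x i v rx)
  (section_monotone x i v rx pv) z0 (profiles_value v i pv).
set U := utility _ z; set V := utility _ _; lra.
Qed.

Lemma canonical_ir x (rx : monotone_rule x) :
  ex_post_ir (canonical_mechanism x rx).
Proof.
move=> v i pv /=; rewrite /canonical_pay opprB addrC subrK.
rewrite /utility mulr_ge0 ?profiles_value//.
by apply: Rintegral_ge0 => s _; case/andP: (rule_unit _ rx i (deviate v i
  (value v i * s))).
Qed.

(* A mechanism is measurable only on [profiles]; extending by [0] makes the
   rule measurable on the plane, and commutes with rescaling. *)
Definition extended_alloc (M : mechanism R) i : profile R -> R :=
  alloc M i \_ @profiles R.

Lemma extended_allocE M i v : profiles v -> extended_alloc M i v = alloc M i v.
Proof. by move=> pv; rewrite /extended_alloc patchE mem_set. Qed.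

Lemma extended_alloc0 M i v : ~ profiles v -> extended_alloc M i v = 0.
Proof. by move=> pv; rewrite /extended_alloc patchE memNset. Qed.

Lemma extended_alloc_monotone M : dsic M -> monotone_rule (extended_alloc M).
Proof.
move=> dM; split.
- move=> i; apply/(measurable_restrictT _ measurable_profiles).
  exact: measurable_alloc.
- move=> i v; have [pv|pv] := pselect (profiles v).
    by rewrite extended_allocE//; exact: alloc_prob.
  by rewrite extended_alloc0// lexx ler01.
- move=> i v z pv vz; have v0 := profiles_value v i pv.
  have z0 := le_trans v0 vz; have pz := profiles_deviate v i z pv z0.
  rewrite !extended_allocE//.
  (* Adding the two DSIC inequalities, for the true values [value v i] and [z], cancels the payments
     and leaves the product of the differences of values and allocations, which is nonnegative. *)
  have := dM v i z pv z0.
  have := dM _ i _ pz v0.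
  rewrite deviate_deviate value_deviate deviate_value.
  move: vz; rewrite le_eqVlt => /predU1P[<-|vz]; first by rewrite deviate_value.
  move=> h1 h2; nra.
Qed.

(** By DSIC the allocation is a subgradient of the truthful utility [u], and by IR [0 <= u 0]. So
    [u] is at least the canonical utility, for the same allocation. *)
Lemma pay_le_canonical M i v : dsic M -> ex_post_ir M -> profiles v ->
  pay M i v <= canonical_pay (extended_alloc M) i v.
Proof.
move=> dM iM pv; have rx := extended_alloc_monotone M dM.
have v0 := profiles_value v i pv.
pose u z := z * alloc M i (deviate v i z) - pay M i (deviate v i z).
have : utility (fun z => extended_alloc M i (deviate v i z)) (value v i) <= u
  (value v i).
  apply: utility_le_subgradient => //; first exact: section_unit.
  - exact: section_monotone.
  - move=> z z' z0 z'0; rewrite extended_allocE; last exact: profiles_deviate.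
    have := dM _ i z (profiles_deviate v i z' pv z'0) z0.
    by rewrite deviate_deviate value_deviate /u; lra.
  - have := iM _ i (profiles_deviate v i 0 pv (lexx 0)).
    by rewrite value_deviate.
by rewrite /canonical_pay /u deviate_value extended_allocE//; lra.
Qed.

End Canonical_mechanism.

(** * Rescaling the values *)

Section Scaling.
Context {R : realType}.
Implicit Types (v : profile R) (i : bool) (x : bool -> profile R -> R)
  (F G : probability R R) (M : mechanism R).

Definition scaled_law (a : R) F G := forall A : set R, measurable A ->
  G A = pushforward F (fun x : R => a * x) A.

Lemma scaled_law_inv a F G : 0 < a -> scaled_law a F G -> scaled_law a^-1 G F.
Proof.
move=> a0 FG A mA; rewrite /pushforward.
have mpre : measurable ((fun x : R => a^-1 * x) @^-1` A).
  by rewrite -[X in measurable X]setTI; apply: measurable_funM.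
rewrite FG// /pushforward; congr (F _); apply/seteqP; split => y /=;
  by rewrite mulrA mulVf ?gt_eqF// mul1r.
Qed.

Definition scaled_rule (a : R) x i v := x i (scale a v).

Lemma scaled_rule_monotone a x : 0 < a -> monotone_rule x ->
  monotone_rule (scaled_rule a x).
Proof.
move=> a0 [mx ux mox]; split.
- by move=> i; apply: measurableT_comp => //; exact: measurable_scale.
- by move=> i v; exact: ux.
- move=> i v z pv vz; rewrite /scaled_rule scale_deviate.
  by apply: mox; [exact/profiles_scale|rewrite value_scale ler_pM2l].
Qed.

Lemma canonical_pay_scaled a x i v : 0 < a ->
  canonical_pay (scaled_rule a x) i v = a^-1 * canonical_pay x i (scale a v).
Proof.
move=> a0; rewrite /canonical_pay /utility value_scale /scaled_rule.
under eq_Rintegral do rewrite scale_deviate mulrA.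
by field; rewrite gt_eqF.
Qed.

Definition canonical_total x v :=
  canonical_pay x false v + canonical_pay x true v.

Lemma canonical_total_bounds x v : monotone_rule x -> profiles v ->
  0 <= canonical_total x v <= v.1 + v.2.
Proof.
move=> rx pv; have := canonical_pay_bounds x false v rx pv.
have /= := canonical_pay_bounds x true v rx pv; rewrite /canonical_total.
by move=> /andP[? ?] /andP[? ?]; rewrite addr_ge0//= lerD.
Qed.

Lemma measurable_canonical_total x : monotone_rule x ->
  measurable_fun setT (canonical_total x).
Proof.
by move=> rx; apply: measurable_funD; exact: measurable_canonical_pay.
Qed.

(** Attached to a rule instead of a mechanism, so that rescaled and averaged rules can be compared
    without carrying their proofs of monotonicity. *)
Definition canonical_revenue x F : \bar R :=
  (\int[F \x F]_(v in @profiles R) (canonical_total x v)%:E)%E.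

Lemma canonical_revenue_ge0 x F : monotone_rule x ->
  (0 <= canonical_revenue x F)%E.
Proof.
move=> rx; apply: integral_ge0 => v pv; rewrite lee_fin.
by have /andP[] := canonical_total_bounds x v rx pv.
Qed.

(** The payments of [M] may be unbounded below, so the negative part of the integrand is dropped
    first and only the positive part is compared. *)
Lemma revenue_le_canonical M F : dsic M -> ex_post_ir M ->
  (revenue M F <= canonical_revenue (extended_alloc M) F)%E.
Proof.
move=> dM iM; rewrite /revenue integralE.
have rx := extended_alloc_monotone M dM.
apply: (@le_trans _ _ (\int[F \x F]_(v in @profiles R)
    ((fun v => (pay M false v + pay M true v)%:E)^\+ v))%E).
  by apply: geeDl; rewrite oppe_le0; apply: integral_ge0 => v _;
    exact: funeneg_ge0.
apply: ge0_le_integral => //.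
- exact: measurable_profiles.
- apply: measurable_funepos; apply/measurable_EFinP.
  by apply: measurable_funD; exact: measurable_pay.
- apply/measurable_EFinP; apply: measurable_funTS.
  exact: measurable_canonical_total.
- move=> v pv; rewrite funeposE ge_max !lee_fin.
  rewrite lerD ?pay_le_canonical//=.
  by have /andP[] := canonical_total_bounds _ v rx pv.
Qed.

(** Both sides agree on measurable rectangles, which determine the product measure. *)
Lemma product_scaled_law a F G A : scaled_law a F G -> measurable A ->
  (G \x G)%E A = pushforward (F \x F)%E (scale a) A.
Proof.
move=> FG mA.
have mphi : measurable_fun setT (@scale R a) by exact: measurable_scale.
pose phi : {mfun profile R >-> profile R} :=
  HB.pack (@scale R a) (isMeasurableFun.Build _ _ _ _ _ mphi).
have := @product_measure_unique _ _ _ _ _ G G (pushforward (F \x F)%E phi).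
apply; last exact: mA.
move=> B C mB mC; rewrite /pushforward.
have ma D : measurable D -> measurable ((fun y : R => a * y) @^-1` D).
  by move=> mD; rewrite -[X in measurable X]setTI; apply: measurable_funM.
transitivity (pushforward F (fun y => a * y)%R B *
    pushforward F (fun y => a * y)%R C)%E.
  by rewrite /pushforward -product_measure1E//; exact: ma.
by congr (_ * _)%E; apply/esym; exact: FG.
Qed.

Lemma canonical_revenue_scaled a x F G : 0 < a -> monotone_rule x ->
  scaled_law a F G ->
  canonical_revenue (scaled_rule a x) F = (a^-1%:E * canonical_revenue x G)%E.
Proof.
move=> a0 rx FG; rewrite /canonical_revenue.
have mt : measurable_fun (@profiles R) (EFin \o canonical_total x).
  by apply: measurable_funTS; apply/measurable_EFinP;
    exact: measurable_canonical_total.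
have t0 v : profiles v -> (0 <= (canonical_total x v)%:E)%E.
  by move=> pv; rewrite lee_fin; have /andP[] := canonical_total_bounds x v rx
    pv.
have mphi : measurable_fun setT (@scale R a) by exact: measurable_scale.
have -> : (\int[G \x G]_(v in @profiles R) (canonical_total x v)%:E =
    \int[pushforward (F \x F) (@scale R a)]_(v in @profiles R)
      (canonical_total x v)%:E)%E.
  by apply: eq_measure_integral => A mA _; exact: product_scaled_law.
rewrite ge0_integral_pushforward//; last 2 first.
- exact: measurable_profiles.
- by move=> v /set_mem; exact: t0.
have -> : @scale R a @^-1` @profiles R = @profiles R.
  by apply/funext => v; apply/propext; exact: profiles_scale.
rewrite -ge0_integralZl//.
- apply: eq_integral => v _; rewrite /= -EFinM.
  by rewrite /canonical_total !canonical_pay_scaled// -mulrDr.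
- exact: measurable_profiles.
- apply: measurable_funTS; apply/measurable_EFinP.
  apply: measurableT_comp; first exact: measurable_canonical_total.
  exact: measurable_scale.
- by move=> v pv; apply: t0; exact/profiles_scale.
- by rewrite lee_fin invr_ge0 ltW.
Qed.

Lemma revenue_canonical x (rx : monotone_rule x) F :
  revenue (canonical_mechanism x rx) F = canonical_revenue x F.
Proof. by []. Qed.

(** A mechanism competing under [F] is replaced, under [G], by the canonical mechanism of its rule
    rescaled by [a^-1], which earns at least [a] times as much. *)
Lemma opt_scaled a F G : 0 < a -> scaled_law a F G ->
  (a%:E * opt F <= opt G)%E.
Proof.
move=> a0 FG; rewrite -lee_pdivlMl//; apply: ge_ereal_sup.
move=> _ [M [fM dM iM] <-]; rewrite lee_pdivlMl//.
have rx := extended_alloc_monotone M dM.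
have av0 : 0 < a^-1 by rewrite invr_gt0.
apply: (@le_trans _ _ (a%:E * canonical_revenue (extended_alloc M) F)%E).
  by rewrite lee_pmul2l ?lte_fin// revenue_le_canonical.
have := canonical_revenue_scaled _ _ _ _ av0 rx (scaled_law_inv _ _ _ a0 FG).
rewrite invrK => <-.
pose N := canonical_mechanism _ (scaled_rule_monotone _ _ av0 rx).
apply: ereal_sup_ubound; exists N => //; split.
- move=> v /(profiles_scale _ _ av0) pv /=; rewrite /scaled_rule
    !extended_allocE//.
  exact: fM.
- exact: canonical_dsic.
- exact: canonical_ir.
Qed.

End Scaling.

(** * Averaging over rescalings *)

Section Averaging.
Context {R : realType}.
Local Notation mu := (@lebesgue_measure R).
Implicit Types (v : profile R) (i : bool) (x : bool -> profile R -> R)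
  (F : probability R R).

Lemma Rintegral_exchange (f : R -> R -> R) a b :
  measurable_fun setT (fun z : R * R => f z.1 z.2) ->
  (forall s u, 0 <= f s u <= 1) ->
  \int[mu]_(s in `[0, a]) \int[mu]_(u in `[0, b]) f s u =
  \int[mu]_(u in `[0, b]) \int[mu]_(s in `[0, a]) f s u.
Proof.
move=> mf f01; rewrite /Rintegral; congr fine.
have E1 s : unit_valued (f s).
  split=> [|u]; last exact: f01.
  exact: (measurableT_comp mf (measurable_fun_pair _ _)).
have E2 u : unit_valued (f ^~ u).
  split=> [|s]; last exact: f01.
  exact: (measurableT_comp mf (measurable_fun_pair _ _)).
transitivity (\int[mu]_(s in `[0%R, a]) \int[mu]_(u in `[0%R, b]) (f s u)%:E)%E.
  by apply: eq_integral => s _; rewrite fineK// integrable_fin_num//;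
    exact: integrable_itv.
rewrite (tonelli_in mu mu _ _ (fun s u => (f s u)%:E))//.
- by apply: eq_integral => u _; rewrite fineK// integrable_fin_num//;
    exact: integrable_itv.
- exact/measurable_EFinP.
- by move=> s u _ _; rewrite lee_fin; case/andP: (f01 s u).
Qed.

Variables (g : R -> R) (mg : measurable_fun setT g) (g0 : forall u, 0 < g u).

Definition averaged_rule x i v : R :=
  \int[mu]_(u in `[0, 1]) scaled_rule (g u) x i v.

Lemma scaled_unit x i v : monotone_rule x ->
  unit_valued (fun u => scaled_rule (g u) x i v).
Proof.
move=> [mx ux _]; split => [|u]; last exact: ux.
by apply: measurableT_comp => //; exact: measurable_scale.
Qed.

Lemma averaged_rule_monotone x : monotone_rule x ->
  monotone_rule (averaged_rule x).
Proof.
move=> rx; have [mx ux _] := rx; split.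
- move=> i; apply: (measurable_Rintegral_param mu _
    (fun v u => x i (scale (g u) v))) => //=.
  + apply: measurableT_comp => //; apply: measurable_scale;
      first exact: measurable_fst.
    by apply: measurableT_comp => //; exact: measurable_snd.
  + by move=> v u; have /andP[] := ux i (scale (g u) v).
- move=> i v; have := itv_integral_bounds _ 0 1 (scaled_unit x i v rx) ler01.
  by rewrite subr0.
- move=> i v z pv vz; apply: le_Rintegral => //.
  + exact/integrable_itv/scaled_unit.
  + exact/integrable_itv/scaled_unit.
  + by move=> u _; apply: rule_monotone vz => //; exact: scaled_rule_monotone.
Qed.

Lemma averaged_rule_feasible x v : monotone_rule x ->
  (forall u, scaled_rule (g u) x false v + scaled_rule (g u) x true v <= 1) ->
  averaged_rule x false v + averaged_rule x true v <= 1.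
Proof.
move=> rx x1; have ix i := integrable_itv _ 0 1 (scaled_unit x i v rx).
rewrite /averaged_rule -RintegralD//.
apply: (@le_trans _ _ (\int[mu]_(u in `[0, 1]) (cst 1 u))); last first.
  by rewrite Rintegral_cst// mul1r [X in fine X]itv_measure// subr0.
apply: le_Rintegral => //.
- exact: (integrableD _ (ix false) (ix true)).
- by apply: integrable_itv; split => // u; rewrite ler01 lexx.
Qed.

Lemma measurable_pay_param x i : monotone_rule x ->
  measurable_fun setT
    (fun z : profile R * R => canonical_pay (scaled_rule (g z.2) x) i z.1).
Proof.
move=> [mx ux _].
have mv : measurable_fun setT (fun z : profile R * R => value z.1 i).
  by apply: (measurableT_comp (measurable_value i)); exact: measurable_fst.
have mg2 : measurable_fun setT (fun z : profile R * R => g z.2).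
  by apply: measurableT_comp => //; exact: measurable_snd.
apply: measurable_funB.
  apply: measurable_funM => //; apply: measurableT_comp => //.
  by apply: measurable_scale => //; exact: measurable_fst.
apply: measurable_funM => //.
apply: (measurable_Rintegral_param mu _ (fun (z : profile R * R) s =>
  x i (scale (g z.2) (deviate z.1 i (value z.1 i * s))))) => //=.
- apply: measurableT_comp => //; apply: measurable_scale.
    apply: measurable_deviate.
      by apply: measurableT_comp; exact: measurable_fst.
    apply: measurable_funM; last exact: measurable_snd.
    by apply: measurableT_comp mv _; exact: measurable_fst.
  by apply: measurableT_comp mg2 _; exact: measurable_fst.
- by move=> z s; case/andP : (ux i (scale (g z.2) (deviate z.1 i (value z.1 i *
    s)))).
Qed.

Lemma integrable_pay_param x i v : monotone_rule x -> profiles v ->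
  mu.-integrable `[0, 1]
    (EFin \o (fun u => canonical_pay (scaled_rule (g u) x) i v)).
Proof.
move=> rx pv; apply: measurable_bounded_integrable => //.
- exact: itv_measure_fin.
- apply: measurable_funTS.
  exact: (measurableT_comp (measurable_pay_param x i rx)
    (measurable_fun_pair _ _)).
- exists (value v i); split; first exact: num_real.
  move=> y /ltW vy u _ /=; apply: le_trans vy.
  have := canonical_pay_bounds _ i v (scaled_rule_monotone _ _ (g0 u) rx) pv.
  by move=> /andP[? ?]; rewrite ger0_norm.
Qed.

(** Canonical payments are linear in the rule; for the utility term this is an exchange of the
    integrals over [s] and [u]. *)
Lemma canonical_pay_averaged x i v : monotone_rule x -> profiles v ->
  canonical_pay (averaged_rule x) i v =
  \int[mu]_(u in `[0, 1]) canonical_pay (scaled_rule (g u) x) i v.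
Proof.
move=> rx pv; have [mx ux _] := rx.
have su := scaled_unit x i v rx.
rewrite /canonical_pay /utility /averaged_rule.
set f := fun s u => scaled_rule (g u) x i (deviate v i (value v i * s)).
have mf : measurable_fun setT (fun z : R * R => f z.1 z.2).
  apply: measurableT_comp => //; apply: measurable_scale.
    apply: measurable_deviate => //.
    by apply: measurable_funM => //; exact: measurable_fst.
  by apply: measurableT_comp => //; exact: measurable_snd.
have f01 s u : 0 <= f s u <= 1 by exact: ux.
rewrite [X in _ - _ * X](Rintegral_exchange f 1 1 mf f01).
have uf : unit_valued (fun u => \int[mu]_(s in `[0, 1]) f s u).
  split.
    apply: (measurable_Rintegral_param mu _ (fun u s => f s u)) => //.
      apply: (measurableT_comp mf (g := fun z : R * R => (z.2, z.1))).
      by apply: measurable_fun_pair; [exact: measurable_snd|exact: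
        measurable_fst].
    by move=> u s; have /andP[] := f01 s u.
  move=> u; have := itv_integral_bounds (f ^~ u) 0 1.
  rewrite subr0; apply; last exact: ler01.
  split=> [|s]; last exact: f01.
  exact: (measurableT_comp mf (measurable_fun_pair _ _)).
have := integrable_itv _ 0 1 su; have := integrable_itv _ 0 1 uf.
move=> i1 i2; rewrite RintegralB//.
- by rewrite !RintegralZl.
- by under [EFin \o _]eq_fun do rewrite EFinM; exact: integrableZl.
- by under [EFin \o _]eq_fun do rewrite EFinM; exact: integrableZl.
Qed.

(** By Tonelli the revenue of the average is the average over [u] of the revenues, each at least
    [c], and [[0, 1]] has mass one. *)
Lemma canonical_revenue_averaged x F (c : \bar R) : monotone_rule x ->
  (forall a, 0 < a -> (c <= canonical_revenue (scaled_rule a x) F)%E) ->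
  (c <= canonical_revenue (averaged_rule x) F)%E.
Proof.
move=> rx cF.
(* The comparison of integrals below needs the constant [c] to be nonnegative; otherwise nonnegative
   revenue suffices. *)
have [c0|/ltW c0] := leP c 0%E.
  by apply: le_trans c0 _; apply: canonical_revenue_ge0;
    exact: averaged_rule_monotone.
pose FF : probability (profile R) R := (F \x F)%E.
pose K v u := (canonical_total (scaled_rule (g u) x) v)%:E.
have K0 v u : profiles v -> (0 <= K v u)%E.
  move=> pv; rewrite lee_fin.
  by have /andP[] := canonical_total_bounds _ v (scaled_rule_monotone _ _ (g0
    u) rx) pv.
have mK : measurable_fun setT (fun z : profile R * R => K z.1 z.2).
  by apply/measurable_EFinP; apply: measurable_funD;
    exact: measurable_pay_param.
have -> : canonical_revenue (averaged_rule x) F =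
    (\int[mu]_(u in `[0%R, 1%R]) canonical_revenue (scaled_rule (g u) x) F)%E.
  transitivity (\int[FF]_(v in @profiles R)
      \int[mu]_(u in `[0%R, 1%R]) K v u)%E; last first.
    rewrite (tonelli_in FF mu _ _ K)//; first exact: measurable_profiles.
    by move=> v u pv _; exact: K0.
  apply: eq_integral => v /set_mem pv.
  rewrite /canonical_total !canonical_pay_averaged//.
  rewrite -RintegralD//; try exact: integrable_pay_param.
  rewrite fineK// integrable_fin_num//.
  under [X in _.-integrable _ X]eq_fun do rewrite /K /canonical_total EFinD.
  by apply: integrableD => //; exact: integrable_pay_param.
have {1}-> : c = (\int[mu]_(u in `[0%R, 1%R]) cst c u)%E.
  by rewrite integral_cst// [X in (_ * X)%E]itv_measure// subr0 mule1.
apply: ge0_le_integral => //.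
- apply: measurable_funTS.
  apply: (measurable_integral_param FF _ (fun u v => K v u)).
  + exact: measurable_profiles.
  + apply: (measurableT_comp mK (g := fun z : R * profile R => (z.2, z.1))).
    by apply: measurable_fun_pair; [exact: measurable_snd|exact:
      measurable_fst].
  + by move=> u v; exact: K0.
- by move=> u _; exact: cF.
Qed.

End Averaging.

(** * Helly selection *)

Section Helly.
Context {R : realType}.

(** Compactness of [[0, 1]] gives a cluster point, and an ultrafilter converges to each of its
    cluster points: it contains the preimage of a given ball or that of its complement, and the
    latter cannot cluster at the centre. *)
Lemma ultrafilter_limit (U : set_system nat) (f : nat -> R) : UltraFilter U ->
  (forall n, 0 <= f n <= 1) ->
  exists p, forall e, 0 < e -> U [set n | `|f n - p| < e].
Proof.
move=> UU f01; have FF : Filter (f @ U) by exact: fmap_filter.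
have : (f @ U) `[0, 1]%classic.
  by apply: (@filterS _ U _ setT) => [n _ /=|]; [rewrite in_itv/=;
    exact: f01|exact: filterT].
move=> /(@segment_compact R 0 1 (f @ U) _) [p [_ cp]].
exists p => e e0; case: (in_ultra_setVsetC [set n | `|f n - p| < e] UU) => //
  UC.
have : (f @ U) [set y | ~ (`|y - p| < e)] by [].
move=> /cp /(_ (nbhsx_ballx p e e0)) [y /= []].
by rewrite /ball/= distrC.
Qed.

(** Stage [k] imposes accuracy [1 / (k + 1)] at the finitely many points with code at most [k].
    These conditions hold together on a set of [U], which also meets every tail of the naturals, so
    an index beyond the previous one exists. *)
Lemma diagonal_extraction (K : countType) (U : set_system nat)
    (f : nat -> K -> R) (l : K -> R) : ProperFilter U -> \oo `<=` U ->
  (forall d e, 0 < e -> U [set n | `|f n d - l d| < e]) ->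
  exists2 phi : nat -> nat, {homo phi : m n / (m < n)%N} &
    forall d, (fun k => f (phi k) d) @ \oo --> l d.
Proof.
move=> UP ooU fl.
have ex (p : nat * nat) : exists n, (p.2 < n)%N /\ forall m d, (m <= p.1)%N ->
    unpickle m = Some d -> `|f n d - l d| < p.1.+1%:R^-1.
  case: p => k N /=.
  have U1 : U [set n | (N < n)%N] by apply: ooU; exact: nbhs_infty_gt.
  have U2 M : U [set n | forall m d, (m < M)%N ->
      unpickle m = Some d -> `|f n d - l d| < k.+1%:R^-1].
    elim: M => [|M IH]; first by apply: filterS filterT.
    have UM : U [set n | forall d, unpickle M = Some d -> `|f n d - l d| <
      k.+1%:R^-1].
      case: (unpickle M) => [d0|]; last by apply: filterS filterT.
      have k0 : 0 < k.+1%:R^-1 :> R by rewrite invr_gt0.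
      by apply: filterS (fl d0 _ k0) => n fd d [<-].
    apply: filterS (filterI IH UM) => n [h1 h2] m d.
    by rewrite ltnS leq_eqVlt => /predU1P[->|]; [exact: h2|exact: h1].
  have [n [n1 n2]] := filter_ex (filterI U1 (U2 k.+1)).
  by exists n; split => // m d mk; apply: n2; rewrite ltnS.
have [g gP] := choice ex.
pose phi := fix phi k := if k is k'.+1 then g (k, phi k') else g (0, 0)%N.
have phiP k m d : (m <= k)%N -> unpickle m = Some d ->
    `|f (phi k) d - l d| < k.+1%:R^-1.
  by case: k => [|k]; [apply: (gP (0, 0)%N).2|apply: (gP (k.+1, phi k)).2].
exists phi.
  apply: homo_ltn; first exact: ltn_trans.
  by move=> k; exact: (gP (k.+1, phi k)).1.
move=> d; apply/cvgrPdist_lt => e e0.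
near=> k; rewrite distrC; apply: (@lt_trans _ _ k.+1%:R^-1).
  apply: (phiP k (pickle d)); last by rewrite pickleK.
  near: k; exact: nbhs_infty_ge.
near: k; exact: near_infty_natSinv_lt (PosNum e0).
Unshelve. all: by end_near. Qed.

(** An ultrafilter supplies a candidate limit at all points at once; diagonal extraction realises it
    along a sequence on a countable set of points, and monotonicity settles all the others. *)
Lemma helly_selection (J : countType) (h : nat -> J -> R -> R) :
  (forall n j r, 0 <= h n j r <= 1) ->
  (forall n j, {homo h n j : x y / x <= y}) ->
  exists2 phi : nat -> nat, {homo phi : m n / (m < n)%N} &
    forall j r, cvgn (fun k => h (phi k) j r).
Proof.
move=> h01 hmono.
have [U [UU ooU]] := @ultraFilterLemma nat \oo _.
have lex (p : J * R) : exists q, forall e, 0 < e ->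
    U [set n | `|h n p.1 p.2 - q| < e].
  by apply: ultrafilter_limit => n; exact: h01.
have [l0 l0P] := choice lex; pose l j r := l0 (j, r).
have lP j r e : 0 < e -> U [set n | `|h n j r - l j r| < e].
  exact: (l0P (j, r)).
have lmono j : {homo l j : x y / x <= y}.
  move=> x y xy; apply/ler_addgt0Pr => e e0; have e20 : 0 < e / 2 by rewrite
    divr_gt0.
  have [n /= [h1 h2]] := filter_ex (filterI (lP j x _ e20) (lP j y _ e20)).
  have := hmono n j _ _ xy; move: h1 h2; rewrite !ltr_distl; lra.
(* A point where the monotone [l j] jumps across the rational [q] is [jump j q],
   so convergence at these points and at the rationals suffices. *)
pose jump j q := sup [set s | l j s <= ratr q].
pose pt (d : J * (rat + rat)) : R :=
  match d.2 with inl q => ratr q | inr q => jump d.1 q end.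
have [phi phim phiP] := diagonal_extraction _ U
  (fun n d => h n d.1 (pt d)) (fun d => l d.1 (pt d)) _ ooU
  (fun d e e0 => lP d.1 (pt d) e e0).
exists phi => // j r.
have [[q qr]|nq] := pselect (exists q, r = jump j q).
  apply: cvgP; rewrite qr; exact: (phiP (j, inr q)).
(* Away from the jumps, convergence at two rationals around [r] where [l j] nearly agrees squeezes
   [h (phi k) j r]. *)
suff close e : 0 < e -> exists s t : rat, [/\ ratr s < r, r < ratr t &
    l j (ratr t) - l j (ratr s) < e].
  apply: (@cvgP _ _ (l j r)); apply/cvgrPdist_lt => e e0.
  have e20 : 0 < e / 2 by rewrite divr_gt0.
  have [s [t [sr rt ts]]] := close _ e20.
  have /cvgrPdist_lt/(_ _ e20) cs := phiP (j, inl s).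
  have /cvgrPdist_lt/(_ _ e20) ct := phiP (j, inl t).
  near=> k.
  have : `|l j (ratr s) - h (phi k) j (ratr s)| < e / 2 by near: k.
  have : `|l j (ratr t) - h (phi k) j (ratr t)| < e / 2 by near: k.
  have := hmono (phi k) j _ _ (ltW sr); have := hmono (phi k) j _ _ (ltW rt).
  have := lmono j _ _ (ltW sr); have := lmono j _ _ (ltW rt).
  rewrite !ltr_distl; lra.
(* Otherwise [l j] rises by at least [e] across [r]. Any rational [q] strictly between the left
   limit [A] and [A + e] then satisfies [r = jump j q], which is excluded. *)
move=> e0; apply: contrapT => far.
have {}far s t : s < r -> r < t -> l j s + e <= l j t.
  move=> sr rt; have [s' /andP[ss' s'r]] := rat_in_itvoo sr.
  have [t' /andP[rt' t't]] := rat_in_itvoo rt.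
  rewrite leNgt; apply/negP => ltse; apply: far; exists s', t'; split => //.
  have := lmono j _ _ (ltW ss'); have := lmono j _ _ (ltW t't); lra.
pose A := sup [set l j s | s in [set s | s < r]].
have ubA : has_ubound [set l j s | s in [set s | s < r]].
  by exists (l j r) => _ [s sr <-]; exact/lmono/ltW.
have lA s : s < r -> l j s <= A by move=> sr; apply: ub_le_sup => //; exists s.
have Al t : r < t -> A + e <= l j t.
  move=> rt; rewrite -lerBrDr; apply: ge_sup; first by exists (l j (r - 1)), (r
    - 1) => //=; rewrite ltrBlDr ltrDl.
  by move=> _ [s sr <-]; rewrite lerBrDr; exact: far.
have [q] : exists q, ratr q \in `]A, A + e[ by apply: rat_in_itvoo;
  rewrite ltrDl.
rewrite in_itv/= => /andP[Aq qA].
apply: nq; exists q; apply/eqP; rewrite eq_le; apply/andP.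
have ub t : l j t <= ratr q -> t <= r.
  move=> tq; rewrite leNgt; apply/negP => /Al; move: qA tq; lra.
have hub : has_ubound [set s | l j s <= ratr q] by exists r => t /ub.
split.
  apply/ler_addgt0Pr => d d0; rewrite -lerBlDr; apply: ub_le_sup => //=.
  by apply: le_trans (ltW Aq); apply: lA; lra.
apply: ge_sup; last by move=> t /ub.
by exists (r - 1) => /=; apply: le_trans (ltW Aq); apply: lA; lra.
Unshelve. all: by end_near. Qed.

End Helly.

(** * Limits of allocation rules *)

Section Limits_of_rules.
Context {R : realType}.
Local Notation mu := (@lebesgue_measure R).
Implicit Types (v : profile R) (i : bool) (F : probability R R).

(** Provides the dominating function for revenues: Tonelli reduces each coordinate to the first
    moment of [F]. *)
Lemma integrable_total_value F : nonneg_finite_mean F ->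
  (F \x F)%E.-integrable (@profiles R) (fun v => (v.1 + v.2)%:E).
Proof.
move=> [_ iF]; pose FF : probability (profile R) R := (F \x F)%E.
apply: (@integrableS _ _ _ FF setT) => //; first exact: measurable_profiles.
have Ffin : (\int[F]_y `|y%:E| < +oo)%E by case/integrableP: iF.
have F1 : F setT = 1%E by exact: probability_setT.
have m1 : measurable_fun setT (EFin \o (fst : profile R -> R)).
  by apply/measurable_EFinP; exact: measurable_fst.
have m2 : measurable_fun setT (EFin \o (snd : profile R -> R)).
  by apply/measurable_EFinP; exact: measurable_snd.
under eq_fun do rewrite EFinD.
apply: integrableD => //; apply/integrableP; split=> //.
- rewrite (fubini_tonelli1 (m1 := F) (m2 := F) (fun v => `|v.1%:E|%E))//.
    rewrite /fubini_F/=; under eq_integral do rewrite integral_cst// [X in (_ *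
      X)%E]F1 mule1.
    exact: Ffin.
  exact: measurableT_comp.
- rewrite (fubini_tonelli1 (m1 := F) (m2 := F) (fun v => `|v.2%:E|%E))//.
    rewrite /fubini_F/= integral_cst// [X in (_ * X)%E]F1 mule1.
    exact: Ffin.
  exact: measurableT_comp.
Qed.

Lemma canonical_revenue_lty x F : monotone_rule x -> nonneg_finite_mean F ->
  (canonical_revenue x F < +oo)%E.
Proof.
move=> rx mF; have iv := integrable_total_value F mF.
have /integrableP[_] := iv; apply: le_lt_trans.
apply: ge0_le_integral => //.
- exact: measurable_profiles.
- by move=> v pv; rewrite lee_fin; have /andP[] := canonical_total_bounds x v
    rx pv.
- by apply: measurable_funTS; apply/measurable_EFinP;
    exact: measurable_canonical_total.
- apply: measurableT_comp => //; exact: (measurable_int (F \x F)%E).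
- move=> v pv; rewrite lee_fin.
  by have /andP[_ h] := canonical_total_bounds x v rx pv;
    apply: le_trans h (ler_norm _).
Qed.

Variables (x_ : nat -> bool -> profile R -> R) (y : bool -> profile R -> R).
Hypothesis rx : forall k, monotone_rule (x_ k).
Hypothesis xy : forall i v, (fun k => x_ k i v) @ \oo --> y i v.

Lemma limit_monotone_rule : monotone_rule y.
Proof.
split.
- move=> i; apply: (measurable_fun_cvg (h := fun k => x_ k i)).
    by move=> k; exact: rule_measurable (rx k) i.
  by move=> v _; exact: xy.
- move=> i v; apply/andP; split.
    apply: (cvgr_to_ge (xy i v)); apply: nearW => k.
    by case/andP: (rule_unit _ (rx k) i v).
  apply: (cvgr_to_le (xy i v)); apply: nearW => k.
  by case/andP: (rule_unit _ (rx k) i v).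
- move=> i v z pv vz; apply: ler_cvg_to (xy i v) (xy i (deviate v i z)) _.
  by apply: nearW => k; exact: rule_monotone.
Qed.

(** The utility term converges by dominated convergence with bound [1]. This integrates along a
    section through [v], which is why convergence of the rules is required at every profile. *)
Lemma cvg_canonical_pay i v : profiles v ->
  (fun k => canonical_pay (x_ k) i v) @ \oo --> canonical_pay y i v.
Proof.
move=> pv; have ry := limit_monotone_rule.
have ux k := section_unit (x_ k) i v (rx k); have uy := section_unit y i v ry.
apply: cvgB; first by apply: cvgM (xy i v); exact: cvg_cst.
apply: cvgM; first exact: cvg_cst.
have resc f : unit_valued f -> unit_valued (fun s => f (value v i * s)).
  move=> [mf uf]; split => //; apply: measurableT_comp => //;
    exact: measurable_funM.
have i1 : mu.-integrable `[0, 1] (EFin \o cst 1).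
  by apply: integrable_itv; split => // s; rewrite ler01 lexx.
apply: fine_cvg; rewrite fineK; last first.
  by apply: integrable_fin_num => //; apply: integrable_itv; exact: (resc _ uy).
apply: (@dominated_cvg _ _ _ mu _ _ _ _ (EFin \o cst 1)) => //.
- by move=> k; apply/measurable_EFinP/measurable_funTS; case: (resc _ (ux k)).
- by move=> s _; apply: cvg_EFin; [exact: nearW|exact: xy].
- move=> k s _ /=; rewrite lee_fin.
  have /andP[? ?] := rule_unit _ (rx k) i (deviate v i (value v i * s)).
  by rewrite ger0_norm.
Qed.

Lemma cvg_canonical_revenue F : nonneg_finite_mean F ->
  (fun k => canonical_revenue (x_ k) F) @ \oo --> canonical_revenue y F.
Proof.
move=> mF; have iv := integrable_total_value F mF.
apply: (@dominated_cvg _ _ _ _ _ _ _ _ (fun v => (v.1 + v.2)%:E)) => //.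
- exact: measurable_profiles.
- by move=> k; apply/measurable_funTS/measurable_EFinP;
    exact: measurable_canonical_total.
- move=> v pv; apply: cvg_EFin; first exact: nearW.
  by apply: cvgD; exact: cvg_canonical_pay.
- move=> k v pv; rewrite lee_fin.
  by have /andP[? ?] := canonical_total_bounds (x_ k) v (rx k) pv;
    rewrite ger0_norm.
Qed.

End Limits_of_rules.

(** * The scale-invariant limit *)

Section Limit_rule.
Context {R : realType}.
Implicit Types (v : profile R) (i : bool) (F : probability R R).

(** For [u] uniform on [[0, 1]], the logarithm of the weight is uniform on [[0, n + 1]]; the
    successor keeps this length positive. *)
Definition log_weight (n : nat) (u : R) : R := expR (n.+1%:R * u).

Lemma measurable_log_weight n : measurable_fun setT (log_weight n).
Proof.
by apply: measurableT_comp; [exact: measurable_expR|exact: measurable_funM].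
Qed.

Lemma log_weight_gt0 n u : 0 < log_weight n u.
Proof. exact: expR_gt0. Qed.

Variables (x : bool -> profile R -> R) (rx : monotone_rule x).
Hypothesis x0 : forall i v, ~ profiles v -> x i v = 0.

Definition log_average n := averaged_rule (log_weight n) x.

Lemma log_average_monotone n : monotone_rule (log_average n).
Proof.
apply: averaged_rule_monotone => //; first exact: measurable_log_weight.
exact: log_weight_gt0.
Qed.

Lemma log_average0 n i v : ~ profiles v -> log_average n i v = 0.
Proof.
move=> pv; rewrite /log_average /averaged_rule.
under eq_Rintegral.
  move=> u _; rewrite /scaled_rule x0; last first.
    by move/(profiles_scale _ _ (log_weight_gt0 n u)).
  over.
by rewrite Rintegral_cst// mul0r.
Qed.

(** Rescaling by [b] translates the logarithmic parameter by [ln b], so [average_shift] applies. *)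
Lemma log_average_scale n i v b : 0 < b ->
  `|log_average n i (scale b v) - log_average n i v| <= `|ln b| / n.+1%:R.
Proof.
move=> b0; have uf : unit_valued (fun t => x i (scale (expR t) v)).
  by apply: (scaled_unit expR _ x i v rx); exact: measurable_expR.
have := average_shift _ n.+1%:R (ln b) uf; rewrite ltr0n => /(_ erefl).
under [X in `|X - _| <= _ -> _]eq_Rintegral.
  move=> u _; rewrite expRD lnK ?posrE// -scale_scale; over.
by [].
Qed.

(** A strictly increasing [phi] satisfies [k <= phi k], so the discrepancy between the two sequences
    is at most [|ln b| / (k + 1)]. *)
Lemma log_average_scale_cvg (phi : nat -> nat) i v b (l : R) :
  {homo phi : m n / (m < n)%N} -> 0 < b ->
  (fun k => log_average (phi k) i v) @ \oo --> l ->
  (fun k => log_average (phi k) i (scale b v)) @ \oo --> l.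
Proof.
move=> phim b0 vl.
have phik k : (k <= phi k)%N.
  by elim: k => // k IH; apply: leq_ltn_trans IH _; exact: phim.
apply: (@cvg_sub0 _ _ _ _ _ _ _ _ _ vl); apply: norm_cvg0.
apply: (@squeeze_cvgr _ _ _ _ (cst 0) (fun k => `|ln b| * @harmonic R k));
  last 2 first.
- exact: cvg_cst.
- by rewrite -[X in _ --> X](mulr0 `|ln b|); apply: cvgM;
    [exact: cvg_cst|exact: cvg_harmonic].
apply: nearW => k; rewrite normr_ge0/=.
apply: le_trans (log_average_scale (phi k) i v b b0) _.
by rewrite ler_wpM2l// lef_pV2 ?posrE// ler_nat ltnS.
Qed.

Lemma log_average_subsequence : exists2 phi : nat -> nat,
  {homo phi : m n / (m < n)%N} &
  forall i v, cvgn (fun k => log_average (phi k) i v).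
Proof.
(* Asymptotic invariance reduces every profile to the ray [(r, 1)], the axis
   point [(1, 0)] (where [j.2] selects a constant function) or the origin. *)
pose h n (j : bool * bool) r := log_average n j.1
  (if j.2 then deviate (0, 0) j.1 1 else deviate (1, 1) j.1 r).
have p1 : @profiles R (1, 1) by split; exact: ler01.
have [| |phi phim phiP] := helly_selection _ h.
- by move=> n j r; exact: (rule_unit _ (log_average_monotone n)).
- move=> n [i []] r s rs; rewrite /h//=.
  (* Monotonicity is needed on the whole line. A negative [r] leaves [profiles], where the extension
     by zero makes the average vanish. *)
  have [r0|r0] := leP 0 r; first exact: (section_monotone _ _ _
    (log_average_monotone n)).
  rewrite log_average0; first by case/andP: (rule_unit _ (log_average_monotone
    n) i (deviate (1, 1) i s)).
  by move/(profiles_value _ i); rewrite value_deviate leNgt r0.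
exists phi => // i v.
have scaled w b : 0 < b -> cvgn (fun k => log_average (phi k) i w) ->
    cvgn (fun k => log_average (phi k) i (scale b w)).
  by move=> b0 /cvg_ex[l wl]; apply: cvgP; exact: log_average_scale_cvg wl.
have [pv|pv] := pselect (profiles v); last first.
  by under eq_fun do rewrite log_average0//; exact: is_cvg_cst.
have vi := profiles_value v i pv; have vj := profiles_value v (~~ i) pv.
have [w0|w0] := eqVneq (value v (~~ i)) 0; last first.
  have {}w0 : 0 < value v (~~ i) by rewrite lt_neqAle eq_sym w0.
  have -> : v = scale (value v (~~ i))
      (deviate (1, 1) i (value v i / value v (~~ i))).
    by rewrite scale_deviate mulrC divfK ?gt_eqF// ray_unit.
  apply: scaled => //; exact: (phiP (i, false)).
have [u0|u0] := eqVneq (value v i) 0; last first.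
  have {}u0 : 0 < value v i by rewrite lt_neqAle eq_sym u0.
  have -> : v = scale (value v i) (deviate (0, 0) i 1).
    by rewrite scale_deviate mulr1 ray_axis.
  apply: scaled => //; exact: (phiP (i, true) 0).
(* Only the origin remains; every rescaling fixes it, so the sequence is constant. *)
have -> : (fun k => log_average (phi k) i v) = fun=> x i v.
  apply/funext => k; rewrite /log_average /averaged_rule.
  under eq_Rintegral do rewrite /scaled_rule (scale_origin _ v i u0 w0).
  by rewrite Rintegral_cst// [X in fine X]itv_measure// subr0 mulr1.
exact: is_cvg_cst.
Qed.

End Limit_rule.

(** * Transfer of revenue guarantees to the limit mechanism *)

Lemma opt_ge0 {R : realType} (M : mechanism R) (F : probability R R) :
  feasible M -> dsic M -> ex_post_ir M -> (0 <= opt F)%E.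
Proof.
move=> fM dM iM; have rx := extended_alloc_monotone M dM.
apply: (@le_trans _ _ (revenue (canonical_mechanism _ rx) F)).
  by rewrite revenue_canonical; exact: canonical_revenue_ge0.
apply: ereal_sup_ubound; exists (canonical_mechanism _ rx) => //; split.
- by move=> v pv /=; rewrite !extended_allocE//; exact: fM.
- exact: canonical_dsic.
- exact: canonical_ir.
Qed.

(** The limit [N] is chosen before [F] and [c], so one mechanism inherits every lower bound that
    holds uniformly over the rescalings. Finiteness of its revenue is recorded for later
    division. *)
Lemma scale_invariant_limit {R : realType} (M : mechanism R) :
  feasible M -> dsic M -> ex_post_ir M ->
  exists N : mechanism R, [/\ feasible N, dsic N, ex_post_ir N,
    scale_invariant N & highest_value_only M -> highest_value_only N] /\
    forall F (c : \bar R), nonneg_finite_mean F ->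
      (forall a, 0 < a ->
        (c <= canonical_revenue (scaled_rule a (extended_alloc M)) F)%E) ->
      (c <= revenue N F < +oo)%E.
Proof.
move=> fM dM iM; set x := extended_alloc M.
have rx : monotone_rule x := extended_alloc_monotone M dM.
have x0 i v : ~ profiles v -> x i v = 0 by exact: extended_alloc0.
have [phi phim cv] := log_average_subsequence x rx x0.
pose y i v := limn (fun k => log_average x (phi k) i v).
have ry_ k : monotone_rule (log_average x (phi k)) by exact:
  log_average_monotone.
have xy i v : (fun k => log_average x (phi k) i v) @ \oo --> y i v by exact: cv.
have ry : monotone_rule y := limit_monotone_rule _ _ ry_ xy.
have pscale n u v : profiles v -> profiles (scale (log_weight n u) v).
  by move=> pv; apply/profiles_scale => //; exact: log_weight_gt0.
exists (canonical_mechanism y ry); split; first split.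
- move=> v pv /=; apply: (cvgr_to_le (cvgD (xy false v) (xy true v))).
  apply: nearW => k; apply: averaged_rule_feasible => //.
    exact: measurable_log_weight.
  move=> u; rewrite /scaled_rule /x !extended_allocE; try exact: pscale.
  exact/fM/pscale.
- exact: canonical_dsic.
- exact: canonical_ir.
- move=> i v a pv a0 /=; apply: cvg_unique (xy i (scale a v)) _ => //.
  exact: (log_average_scale_cvg _ rx _ _ _ _ _ phim a0 (xy i v)).
- move=> hM v i pv vv /=; apply: cvg_unique (xy i v) _ => //.
  have -> : (fun k => log_average x (phi k) i v) = cst 0; last exact: cvg_cst.
  apply/funext => k; rewrite /log_average /averaged_rule.
  under eq_Rintegral.
    move=> u _; rewrite /scaled_rule /x extended_allocE; last exact: pscale.
    rewrite hM; last 2 first.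
    + exact: pscale.
    + by rewrite !value_scale ltr_pM2l// log_weight_gt0.
    over.
  by rewrite Rintegral_cst// mul0r.
- move=> F c mF cF; rewrite revenue_canonical canonical_revenue_lty// andbT.
  apply: (cvge_to_ge (cvg_canonical_revenue _ _ ry_ xy F mF)).
  apply: nearW => k; apply: canonical_revenue_averaged => //.
  + exact: measurable_log_weight.
  + exact: log_weight_gt0.
Qed.

(** The factor [a^-1] from rescaling the revenue cancels the factor [a] in [opt_scaled]. The
    guarantee is assumed only at laws of [a V], so the lemma also serves constants valid merely
    along one orbit. *)
Lemma guarantee_scaled {R : realType} (M : mechanism R)
    (Fam : set (probability R R)) (rho : R) F a :
  dsic M -> ex_post_ir M -> scale_closed Fam -> 0 <= rho -> 0 < a -> Fam F ->
  (forall G, Fam G -> scaled_law a F G -> (rho%:E * opt G <= revenue M G)%E) ->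
  (rho%:E * opt F <=
    canonical_revenue (scaled_rule a (extended_alloc M)) F)%E.
Proof.
move=> dM iM Fs rho0 a0 FF hG; have [G FG FGs] := Fs _ _ FF a0.
rewrite (canonical_revenue_scaled _ _ _ _ a0 (extended_alloc_monotone _ dM)
  FGs).
rewrite lee_pdivlMl//.
apply: le_trans (revenue_le_canonical _ _ dM iM).
apply: le_trans (hG _ FG FGs).
by rewrite muleCA lee_wpmul2l ?lee_fin// opt_scaled.
Qed.

Theorem theorem1 (R : realType)
    (Fam : set (probability R R))
    (Fam_mean : forall F, Fam F -> nonneg_finite_mean F)
    (Fam_scale : scale_closed Fam)
    (rho : R) (rho_ge0 : 0 <= rho)
    (M : mechanism R)
    (M_feasible : feasible M) (M_dsic : dsic M) (M_ir : ex_post_ir M)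
    (M_rho : forall F, Fam F -> (rho%:E * opt F <= revenue M F)%E) :
  exists Mhat : mechanism R,
    [/\ feasible Mhat, dsic Mhat, ex_post_ir Mhat & scale_invariant Mhat] /\
    [/\ forall F, Fam F -> (rho%:E * opt F <= revenue Mhat F)%E,
        (approx_ratio Mhat Fam <= approx_ratio M Fam)%E &
        highest_value_only M -> highest_value_only Mhat].
Proof.
have [N [[fN dN iN sN hN] revN]] := scale_invariant_limit M M_feasible M_dsic
  M_ir.
exists N; split; first by split.
have opt0 (F : probability R R) : (0 <= opt F)%E by exact: (opt_ge0 M).
have transfer r F : 0 <= r -> Fam F ->
    (forall G a, 0 < a -> Fam G -> scaled_law a F G ->
      (r%:E * opt G <= revenue M G)%E) ->
    (r%:E * opt F <= revenue N F < +oo)%E.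
  move=> r0 FF h; apply: revN; first exact: Fam_mean.
  move=> a a0; apply: (guarantee_scaled M Fam r F a) => // G FG FGs;
    exact: (h G a).
have revM0 F : Fam F -> (0 <= revenue M F)%E.
  by move=> /M_rho; apply: le_trans; rewrite mule_ge0.
have revM_lty F : Fam F -> (revenue M F < +oo)%E.
  move=> FF; apply: le_lt_trans (revenue_le_canonical _ _ M_dsic M_ir) _.
  apply: canonical_revenue_lty (Fam_mean _ FF).
  exact: extended_alloc_monotone.
split => //.
  by move=> F FF; have /andP[] := transfer rho F rho_ge0 FF (fun G _ _ FG _ =>
    M_rho G FG).
apply: ge_ereal_sup => _ [F FF <-].
(* If [alpha] is finite, then [alpha^-1] is also a guarantee of [M], at least on
   the orbit of an [F] with [opt F > 0], and transfers to [N]. *)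
set alpha := approx_ratio M Fam.
have le_alpha G : Fam G -> (opt G / revenue M G <= alpha)%E.
  by move=> FG; apply: ereal_sup_ubound; exists G.
have alpha0 : (0 <= alpha)%E.
  by apply: le_trans (le_alpha F FF); rewrite mule_ge0// inve_ge0 revM0.
have [->|optF] := eqVneq (opt F) 0%E; first by rewrite mul0e.
have {}optF : (0 < opt F)%E by rewrite lt_neqAle eq_sym optF opt0.
(* [opt] stays positive along the orbit of [F], so a zero revenue of [M] there makes the ratio
   [+oo], and [alpha] with it. *)
have ratio G a : 0 < a -> Fam G -> scaled_law a F G ->
  (0 < opt G)%E /\ (alpha = +oo \/ opt G <= alpha * revenue M G)%E.
  move=> a0 FG FGs; have optG : (0 < opt G)%E.
    by apply: lt_le_trans (opt_scaled a F G a0 FGs); rewrite mule_gt0.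
  split => //; have := le_alpha G FG; have := revM0 G FG; have := revM_lty G FG.
  case: (revenue M G) => [r _ r0| |]//; rewrite lee_fin le_eqVlt in r0.
  move: r0 => /predU1P[<-|r0]; first by rewrite inve0 gt0_muley// leye_eq =>
    /eqP; left.
  by rewrite inver gt_eqF// lee_pdivrMr// => ?; right.
case E : alpha alpha0 => [al| |] //; last by move=> _; rewrite leey.
rewrite lee_fin => al0.
have FF1 : scaled_law 1 F F.
  move=> A mA; rewrite /pushforward; congr (F _).
  by apply/seteqP; split => z /=; rewrite mul1r.
(* A zero [al] would give [opt F <= 0], by the bound at [F] itself, the rescaling of [F] by [1]. *)
have {}al0 : 0 < al.
  rewrite lt_neqAle al0 andbT; apply/negP => /eqP al1.
  have [_ []] := ratio F 1 ltr01 FF FF1; rewrite E// -al1 mul0e.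
  by rewrite leNgt optF.
have /andP[] : (al^-1%:E * opt F <= revenue N F < +oo)%E.
  apply: transfer => //; first by rewrite invr_ge0 ltW.
  move=> G a a0 FG FGs; have [_ []] := ratio G a a0 FG FGs; rewrite E//.
  by rewrite lee_pdivrMl.
(* The bound [opt F <= al * revenue N F] with [opt F > 0] excludes revenue [-oo] and then any
   nonpositive value, so the ratio is an ordinary quotient. *)
rewrite lee_pdivrMl//; case: (revenue N F) => [r h _| |]//; last first.
  by rewrite mulrNy gtr0_sg// mul1e leNgt (lt_trans _ optF)// ltNy0.
have r0 : 0 < r.
  rewrite ltNge; apply/negP => r0; move: h; rewrite leNgt (le_lt_trans _
    optF)//.
  by rewrite -EFinM lee_fin mulr_ge0_le0// ltW.
by rewrite inver gt_eqF// lee_pdivrMr.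
Qed.
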